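(* Let $\mathbb{H}$ be a real-valued function on classical channels (between finite alphabets) that is monotone under classical channel majorization ($\mathcal{N}\succ\mathcal{M}\Rightarrow\mathbb{H}(\mathcal{N})\le\mathbb{H}(\mathcal{M})$), additive under tensor products, and equal to the Shannon entropy $H$ on probability vectors (channels with trivial input). Then for every classical channel $\mathcal{N}$ from $X$ ($|X|=m$) to $Y$ with columns $\mathbf{p}_x=\mathcal{N}(\mathbf{e}_x)$, $$\mathbb{H}(Y|X)_{\mathcal{N}}=\underline{H}^{\mathrm{reg}}(Y|X)_{\mathcal{N}}=\overline{H}(Y|X)_{\mathcal{N}}=\min_{x\in[m]}H(\mathbf{p}_x).$$
   Context: $H(\mathbf{p})=-\sum_ip_i\log p_i$. Vector majorization $\mathbf{p}\succ\mathbf{q}$: the sum of the $k$ largest entries of $\mathbf{p}$ is at least that of $\mathbf{q}$ for all $k$ (vectors of different lengths compared after zero-padding). Classical channels are column-stochastic matrices; $\mathcal{N}\otimes\mathcal{M}$ has columns $\mathcal{N}(\mathbf{e}_x)\otimes\mathcal{M}(\mathbf{e}_{x'})$. Classical channel majorization (same output $Y$): $\mathcal{N}\succ\mathcal{M}$ iff $\mathcal{M}=\mathcal{D}^{YZ\to Y}\circ(\mathcal{N}\otimes\mathrm{id}^Z)\circ\mathcal{S}^{X'\to XZ}$ for a finite classical system $Z$ and classical channels $\mathcal{S},\mathcal{D}$ with $\mathcal{D}(\cdot\otimes\mathbf{e}_z)$ doubly stochastic for all $z$; channels with different output sizes are compared after padding the smaller outputs with zeros. For a probability vector $\mathbf{q}$,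 $\mathbf{q}\succ\mathcal{N}$ means $\mathbf{q}\succ\mathbf{p}_x$ for all $x$. Maximal extension: $\overline{H}(Y|X)_{\mathcal{N}}:=\inf\{H(\mathbf{q}):\mathcal{N}\succ\mathbf{q}\}$; minimal extension: $\underline{H}(Y|X)_{\mathcal{N}}:=\sup\{H(\mathbf{q}):\mathbf{q}\succ\mathcal{N}\}$ (over probability vectors of arbitrary finite length); regularized minimal extension: $\underline{H}^{\mathrm{reg}}(Y|X)_{\mathcal{N}}:=\lim_{k\to\infty}\frac1k\underline{H}(Y^k|X^k)_{\mathcal{N}^{\otimes k}}$. *)

(* Defs.v *)
From HB Require Import structures.
From mathcomp Require Import all_boot all_order all_algebra.
From mathcomp Require Import mxtens.
From mathcomp Require Import all_classical all_reals all_analysis.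

Set Implicit Arguments.
Unset Strict Implicit.
Unset Printing Implicit Defensive.

Import Order.TTheory GRing.Theory Num.Theory.
Local Open Scope classical_set_scope.
Local Open Scope ring_scope.

Section ChannelDefs.
Variable R : realType.

(* A classical channel from X (|X| = m) to Y (|Y| = n) is a column-stochastic
   n x m matrix; column x is N(e_x).  Alphabets are nonempty (0 < m). *)
Definition is_channel {n m : nat} (N : 'M[R]_(n, m)) : Prop :=
  [/\ (0 < m)%N, (forall i j, 0 <= N i j) & (forall j, \sum_i N i j = 1)].

Definition doubly_stochastic {n : nat} (A : 'M[R]_n) : Prop :=
  [/\ (forall i j, 0 <= A i j), (forall i, \sum_j A i j = 1)
    & (forall j, \sum_i A i j = 1)].

Definition pad_out (d : nat) {n m : nat} (N : 'M[R]_(n, m)) : 'M[R]_(d, m) :=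
  \matrix_(i < d, j < m)
    (if (insub (val i) : option 'I_n) is Some i' then N i' j else 0).

(* channel majorization for channels with the same output Y (|Y| = d):
   M = D o (N (x) id_Z) o S, with |Z| = k, the pair (x,z) / (y,z) being
   indexed by mxtens_index, tensor product = Kronecker product tensmx. *)
Definition chmaj_same {d m m' : nat} (N : 'M[R]_(d, m)) (M : 'M[R]_(d, m'))
  : Prop :=
  exists (k : nat) (S : 'M[R]_(m * k, m')) (D : 'M[R]_(d, d * k)),
    [/\ is_channel S, is_channel D,
        (forall z : 'I_k,
            doubly_stochastic (\matrix_(y < d, y' < d) D y (mxtens_index (y', z))))
      & M = D *m (N *t (1%:M : 'M[R]_k)) *m S].

Definition chmaj {n m n' m' : nat} (N : 'M[R]_(n, m)) (M : 'M[R]_(n', m'))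
  : Prop :=
  chmaj_same (pad_out (maxn n n') N) (pad_out (maxn n n') M).

(* Shannon entropy of a probability vector (natural log; ln 0 = 0 so that
   0 log 0 = 0) *)
Definition entropy {n : nat} (p : 'cV[R]_n) : R :=
  - \sum_(i < n) p i 0 * ln (p i 0).

(* sum of the k largest entries of a (finite) list; taking fewer than k
   entries when the list is short is the zero-padding convention *)
Definition topk (s : seq R) (k : nat) : R :=
  \sum_(x <- take k (sort (fun x y : R => y <= x) s)) x.

Definition entries {n : nat} (p : 'cV[R]_n) : seq R :=
  [seq p i 0 | i <- enum 'I_n].

Definition vmaj {n n' : nat} (p : 'cV[R]_n) (q : 'cV[R]_n') : Prop :=
  forall k : nat, topk (entries q) k <= topk (entries p) k.

Definition Hmax {n m : nat} (N : 'M[R]_(n, m)) : R :=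
  inf [set r | exists (l : nat) (q : 'cV[R]_l),
                 [/\ is_channel q, chmaj N q & r = entropy q]].

(* minimal extension: sup { H(q) : q > N }, q > N iff q > p_x for all x *)
Definition Hmin {n m : nat} (N : 'M[R]_(n, m)) : R :=
  sup [set r | exists (l : nat) (q : 'cV[R]_l),
                 [/\ is_channel q, (forall x : 'I_m, vmaj q (col x N))
                   & r = entropy q]].

Definition minH {n m : nat} (N : 'M[R]_(n, m.+1)) : R :=
  \big[Num.min/entropy (col ord0 N)]_(x < m.+1) entropy (col x N).

End ChannelDefs.

(* Main.v *)
(* Write h = min_x H(p_x).  Since N > p_x, monotonicity gives HH(N) <= h.
   Conversely, a vector q above every column of N satisfies q > N as a channel
   (Hardy-Littlewood-Polya, with the input x selecting the doubly stochastic
   map), so H(q) = HH(q) <= HH(N), and additivity turns this into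
   Hmin(N^k) / k <= HH(N).  It remains to see that Hmin(N^k) / k is eventually
   at least h - e.  By a Chernoff bound on sum_y p(y)^(1+t), which is
   multiplicative under tensor products, each column of N^k has all but an
   exponentially small mass on outcomes of probability at most
   exp(-k (h - e/2)); hence one spike followed by a flat part at this height
   majorizes all columns, and its entropy is about k (h - e/2).
   Finally Hmax = h by concavity of the entropy. *)
Require Import Defs.
From HB Require Import structures.
From mathcomp Require Import all_boot all_order all_algebra.
From mathcomp Require Import fingroup perm mxtens.
From mathcomp Require Import all_classical all_reals all_analysis.
From mathcomp Require Import ring lra.
Import Order.TTheory GRing.Theory Num.Theory numFieldNormedType.Exports.
Local Open Scope classical_set_scope.
Local Open Scope ring_scope.

(** * The Hardy-Littlewood-Polya theorem *)

Lemma doubly_stochastic1 (R : realType) d : doubly_stochastic (1%:M : 'M[R]_d).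
Proof.
split=> [i j|i|j]; first by rewrite !mxE; case: (_ == _).
- rewrite (bigD1 i) //= big1 ?mxE ?eqxx ?addr0 // => j ji.
  by rewrite mxE eq_sym (negbTE ji).
- rewrite (bigD1 j) //= big1 ?mxE ?eqxx ?addr0 // => i ij.
  by rewrite mxE (negbTE ij).
Qed.

Lemma doubly_stochastic_mul (R : realType) d (A B : 'M[R]_d) :
  doubly_stochastic A -> doubly_stochastic B -> doubly_stochastic (A *m B).
Proof.
move=> [A0 Ar Ac] [B0 Br Bc]; split=> [i j|i|j].
- by rewrite mxE sumr_ge0 // => k _; rewrite mulr_ge0.
- under eq_bigr do rewrite mxE; rewrite exchange_big /= -(Ar i).
  by apply: eq_bigr => k _; rewrite -mulr_sumr Br mulr1.
- under eq_bigr do rewrite mxE; rewrite exchange_big /= -(Bc j).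
  by apply: eq_bigr => k _; rewrite -mulr_suml Ac mul1r.
Qed.

Lemma doubly_stochastic_convex (R : realType) d (t : R) (A B : 'M[R]_d) :
  0 <= t <= 1 -> doubly_stochastic A -> doubly_stochastic B ->
  doubly_stochastic ((1 - t) *: A + t *: B).
Proof.
move=> /andP[t0 t1] [A0 Ar Ac] [B0 Br Bc]; split=> [i j|i|j].
- by rewrite !mxE addr_ge0 // mulr_ge0 // subr_ge0.
- under eq_bigr do rewrite !mxE.
  by rewrite big_split /= -!mulr_sumr Ar Br !mulr1 subrK.
- under eq_bigr do rewrite !mxE.
  by rewrite big_split /= -!mulr_sumr Ac Bc !mulr1 subrK.
Qed.

Lemma doubly_stochastic_perm (R : realType) d (s : 'S_d) :
  doubly_stochastic (perm_mx s : 'M[R]_d).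
Proof.
split=> [i j|i|j]; first by rewrite !mxE; case: (_ == _).
- rewrite (bigD1 (s i)) //= big1 ?mxE ?eqxx ?addr0 // => j ji.
  by rewrite !mxE eq_sym (negbTE ji).
- rewrite (bigD1 ((s^-1)%g j)) //= big1 ?mxE ?permKV ?eqxx ?addr0 // => i ij.
  rewrite !mxE; case: eqP => // sij; case/eqP: ij.
  by rewrite -sij permK.
Qed.

Section HardyLittlewoodPolya.
Context {R : realType} {d : nat}.
Implicit Types p q : 'cV[R]_d.

(** Moving mass [e] from [j] to [k] affects a sum over [P] only when [P] separates the two indices.
    This evaluates the partial sums after a T-transform. *)
Lemma sum_transfer p (P : pred 'I_d) (j k : 'I_d) (e : R) :
  \sum_(i | P i) (p i 0 + (e *+ (i == k) - e *+ (i == j))) =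
  \sum_(i | P i) p i 0 + (e *+ P k - e *+ P j).
Proof.
have sum1 l : \sum_(i | P i) e *+ (i == l) = e *+ P l.
  rewrite big_mkcond (bigD1 l) //= eqxx big1 ?addr0 => [|i /negbTE ->].
    by case: (P l).
  by rewrite if_same.
by rewrite big_split sumrB /= !sum1.
Qed.

(** At the first disagreement [i0] the partial sums force [p < q], and equal totals then force
    [q < p] at some later index. Among all such pairs take one at minimal distance: a disagreement
    strictly between would give a closer pair, whatever its sign. *)
Lemma crossing_pair p q :
  (forall l : nat, \sum_(i < d | (i < l)%N) p i 0 <= \sum_(i < d | (i < l)%N) q i 0) ->
  \sum_i p i 0 = \sum_i q i 0 -> p != q ->
  exists j k : 'I_d, [/\ (j < k)%N, p j 0 < q j 0, q k 0 < p k 0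
    & forall i : 'I_d, (j < i < k)%N -> p i 0 = q i 0].
Proof.
move=> cum tot pq.
have /existsP[i1 i1P] : [exists i, p i 0 != q i 0].
  apply: contraNT pq; rewrite negb_exists => /forallP E.
  by apply/eqP/colP => i; apply/eqP; rewrite -[_ == _]negbK.
have [i0 i0P i0min] := @arg_minnP _ i1 (fun i => p i 0 != q i 0) val i1P.
have eq_before (i : 'I_d) : (i < i0)%N -> p i 0 = q i 0.
  by move=> ii0; apply/eqP; apply: contraTT ii0 => /i0min; rewrite -leqNgt.
have lt0 : p i0 0 < q i0 0.
  rewrite lt_neqAle i0P /=; have := cum i0.+1.
  rewrite (bigD1 i0) //= [leRHS](bigD1 i0) //=.
  rewrite (eq_bigr (fun i => q i 0)) ?lerD2r // => i /andP[].
  rewrite ltnS leq_eqVlt => /orP[/eqP/val_inj ->|/eq_before //].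
  by rewrite eqxx.
have /existsP[k0 k0P] : [exists k, q k 0 < p k 0].
  apply: contraTT isT; rewrite negb_exists => /forallP E.
  have : \sum_i p i 0 < \sum_i q i 0.
    rewrite (bigD1 i0) //= [ltRHS](bigD1 i0) //= ltr_leD // ler_sum // => i _.
    by rewrite leNgt.
  by rewrite tot ltxx.
have ik0 : (i0 < k0)%N.
  rewrite ltnNge; apply/negP; rewrite leq_eqVlt => /orP[/eqP/val_inj E|/eq_before E].
    by move: k0P lt0; rewrite E => /lt_trans h /h; rewrite ltxx.
  by rewrite E ltxx in k0P.
pose P (u : 'I_d * 'I_d) :=
  [&& (u.1 < u.2)%N, p u.1 0 < q u.1 0 & q u.2 0 < p u.2 0].
have P0 : P (i0, k0) by rewrite /P /= ik0 lt0 k0P.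
have [[j k] /and3P[/= jk pqj qpk] jkmin] := @arg_minnP _ (i0, k0) P (fun u => u.2 - u.1)%N P0.
exists j, k; split=> // i /andP[ji ik].
case: (ltgtP (p i 0) (q i 0)) => // h.
- have := jkmin (i, k); rewrite /P /= ik h qpk => /(_ isT).
  by rewrite leqNgt ltn_sub2l.
- have := jkmin (j, i); rewrite /P /= ji h pqj => /(_ isT).
  by rewrite leqNgt ltn_sub2r.
Qed.

(* A T-transform on a crossing pair makes one more coordinate of q agree with
   p and keeps the partial-sum inequalities; q itself need not stay sorted. *)
Lemma partial_sums_doubly_stochastic p q :
  (forall i j : 'I_d, (i <= j)%N -> p j 0 <= p i 0) ->
  (forall l : nat, \sum_(i < d | (i < l)%N) p i 0 <= \sum_(i < d | (i < l)%N) q i 0) ->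
  \sum_i p i 0 = \sum_i q i 0 ->
  exists2 D : 'M[R]_d, doubly_stochastic D & p = D *m q.
Proof.
move=> p_sorted.
(* Induction on the number of coordinates where [p] and [q] disagree. *)
have [n] := ubnP #|[pred i | p i 0 != q i 0]|.
elim: n q => // n IH q; rewrite ltnS => card_n cum tot.
have [->|pq] := eqVneq p q.
  by exists 1%:M; [exact: doubly_stochastic1 | rewrite mul1mx].
have [j [k [jk pqj qpk eqjk]]] := crossing_pair _ _ cum tot pq.
have pkj : p k 0 <= p j 0 by apply: p_sorted; exact: ltnW.
have kj : (k == j) = false by apply/negbTE; rewrite -val_eqE neq_ltn jk orbT.
(* The smaller of the two gaps: moving [e] from [j] to [k] closes one gap and overshoots neither. *)
pose e := Num.min (q j 0 - p j 0) (p k 0 - q k 0).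
have e0 : 0 < e by rewrite lt_min !subr_gt0 pqj.
have e1 : e <= q j 0 - p j 0 by rewrite ge_min lexx.
have e2 : e <= p k 0 - q k 0 by rewrite ge_min lexx orbT.
(* Mixing the identity with the swap of [j] and [k] at weight [t] moves exactly
   [t * (q j 0 - q k 0) = e]. Since [p] is sorted, [e <= q j 0 - p j 0 <= q j 0 - q k 0], hence
   [t <= 1]. *)
pose t := e / (q j 0 - q k 0).
have qjk : 0 < q j 0 - q k 0 by lra.
have t01 : 0 <= t <= 1.
  by apply/andP; split; [rewrite divr_ge0 ?ltW | rewrite ler_pdivrMr // mul1r; lra].
pose T : 'M[R]_d := (1 - t) *: 1%:M + t *: perm_mx (tperm j k).
have Tds : doubly_stochastic T.
  apply: doubly_stochastic_convex => //; first exact: doubly_stochastic1.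
  exact: doubly_stochastic_perm.
have tE : t * (q j 0 - q k 0) = e by rewrite /t divfK // gt_eqF.
have TqE i : (T *m q) i 0 = q i 0 + (e *+ (i == k) - e *+ (i == j)).
  rewrite mulmxDl -!scalemxAl mul1mx -row_permE !mxE -tE.
  case: tpermP => [->|->|/eqP/negbTE -> /eqP/negbTE ->].
  - by rewrite [j == k]eq_sym kj eqxx /= mulr0n mulr1n; ring.
  - by rewrite kj eqxx /= mulr0n mulr1n; ring.
  - by rewrite /= !mulr0n; ring.
have [D Dds ->] : exists2 D : 'M[R]_d, doubly_stochastic D & p = D *m (T *m q).
  apply: IH.
  - apply: leq_trans card_n; apply/proper_card/properP; split.
      apply/fintype.subsetP => i; rewrite !inE TqE; apply: contraNN => /eqP pqi.
      have [ik|_] := eqVneq i k; first by move: qpk; rewrite -ik pqi ltxx.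
      have [ij|_] := eqVneq i j; first by move: pqj; rewrite -ij pqi ltxx.
      by rewrite pqi subr0 addr0.
    have [ej|ek] := leP (q j 0 - p j 0) (p k 0 - q k 0).
    + exists j; first by rewrite inE lt_eqF.
      rewrite !inE TqE [j == k]eq_sym kj eqxx negbK.
      rewrite /= mulr0n mulr1n /e min_l //; apply/eqP; ring.
    + exists k; first by rewrite inE gt_eqF.
      rewrite !inE TqE kj eqxx negbK.
      rewrite /= mulr0n mulr1n /e min_r ?ltW //; apply/eqP; ring.
  - move=> l; under [leRHS]eq_bigr do rewrite TqE.
    have [lj|jl] := leqP l j.
      rewrite sum_transfer !ltnNge lj (leq_trans lj (ltnW jk)) /=.
      by rewrite subr0 addr0.
    have [lk|kl] := leqP l k; last first.
      by rewrite sum_transfer kl jl subrr addr0.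
    (* Here [j < l <= k], so the mass taken from [j] is not yet returned. Before [j] the old
       inequality applies; from [j] on the comparison is termwise, as [q j 0 - e >= p j 0] and [p],
       [q] agree strictly between [j] and [k]. *)
    rewrite (bigID (fun i : 'I_d => (i < j)%N)) [leRHS](bigID (fun i : 'I_d => (i < j)%N)) /=.
    apply: lerD.
      have rE (F : 'I_d -> R) :
          \sum_(i < d | (i < l)%N && (i < j)%N) F i = \sum_(i < d | (i < j)%N) F i.
        by apply: eq_bigl => i; case: (ltnP i j) => ij; rewrite ?andbF // (ltn_trans ij jl).
      by rewrite !rE sum_transfer ltnn ltnNge (ltnW jk) subr0 addr0.
    apply: ler_sum => i /andP[il]; rewrite -leqNgt => ji.
    have ik : (i < k)%N := leq_trans il lk.
    rewrite -[i == k]val_eqE (ltn_eqF ik).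
    have [->|ij] := eqVneq i j; first by rewrite mulr0n mulr1n; lra.
    by rewrite subr0 addr0 eqjk // ik ltn_neqAle ji andbT eq_sym val_eqE ij.
  - under [RHS]eq_bigr do rewrite TqE.
    by rewrite sum_transfer subrr addr0.
exists (D *m T); [exact: doubly_stochastic_mul | by rewrite mulmxA].
Qed.

(** Turns the list-based [topk] into partial sums of a decreasing rearrangement, the form that the
    T-transform argument uses. *)
Lemma topk_sorting p : exists s : 'S_d,
  (forall i j : 'I_d, (i <= j)%N -> p (s j) 0 <= p (s i) 0) /\
  (forall l, topk (entries p) l = \sum_(i < d | (i < l)%N) p (s i) 0).
Proof.
pose ge (x y : R) := y <= x.
have ge_trans : transitive ge by move=> y x z xy yz; exact: le_trans yz xy.
have sz : size (sort ge (entries p)) = d.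
  by rewrite size_sort size_map size_enum_ord.
have : perm_eq (sort ge (entries p)) [tuple p i 0 | i < d].
  by rewrite perm_sort.
move=> /tuple_permP[s sE]; exists s.
have nthE (i : 'I_d) : p (s i) 0 = nth 0 (sort ge (entries p)) i.
  rewrite sE (nth_map i) ?size_enum_ord // nth_ord_enum.
  by rewrite tnth_mktuple.
split=> [i j ij|l].
  rewrite !nthE.
  have := @sorted_leq_nth R ge ge_trans _ 0 (sort ge (entries p)).
  apply => //; first by move=> x; rewrite /ge.
  - by apply: sort_sorted => x y; exact: le_total.
  - by rewrite inE sz.
  - by rewrite inE sz.
under [RHS]eq_bigr do rewrite nthE.
rewrite /topk -/ge -(big_mkord (fun i => (i < l)%N) (nth 0 (sort ge (entries p)))).
have [ld|dl] := leqP l d.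
  rewrite (big_nth 0) size_take sz.
  have -> : (if (l < d)%N then l else d) = l by case: ltngtP ld.
  rewrite (big_nat_widen _ _ d) //=.
  by apply: eq_bigr => i il; rewrite nth_take.
rewrite take_oversize ?sz ?(ltnW dl) // (big_nth 0) sz big_nat [RHS]big_nat_cond.
by apply: eq_bigl => i; case: (ltnP i d) => // id; rewrite (ltn_trans id dl).
Qed.

(** Sort both vectors, apply the sorted case, and undo the sorting of [p]. Permutation matrices are
    doubly stochastic, so the product is too. *)
Lemma vmaj_doubly_stochastic p q :
  vmaj q p -> \sum_i p i 0 = \sum_i q i 0 ->
  exists2 D : 'M[R]_d, doubly_stochastic D & p = D *m q.
Proof.
move=> qp tot; have [s [sp sE]] := topk_sorting p.
have [u [_ uE]] := topk_sorting q.
have [| | |D Dds DE] := partial_sums_doubly_stochastic (row_perm s p) (row_perm u q).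
- by move=> i j ij; rewrite !mxE sp.
- move=> l; under eq_bigr do rewrite mxE; under [leRHS]eq_bigr do rewrite mxE.
  by rewrite -sE -uE.
- under eq_bigr do rewrite mxE; under [RHS]eq_bigr do rewrite mxE.
  by rewrite -(reindex_inj perm_inj (P := xpredT) (F := fun i => p i 0))
             -(reindex_inj perm_inj (P := xpredT) (F := fun i => q i 0)).
exists (perm_mx (s^-1)%g *m D *m perm_mx u).
  by apply: doubly_stochastic_mul; [apply: doubly_stochastic_mul|];
     do ?[exact: doubly_stochastic_perm].
rewrite -!mulmxA -[perm_mx u *m q]row_permE -DE row_permE mulmxA -perm_mxM.
by rewrite mulVg perm_mx1 mul1mx.
Qed.

End HardyLittlewoodPolya.

(** * Channel majorization *)

Section Padding.
Context {R : realType}.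

(** Stated for any [f] vanishing at 0, to cover both column sums and the entropy summand
    [x * ln x]. *)
Lemma sum_pad_out d n m (N : 'M[R]_(n, m)) (f : R -> R) (j : 'I_m) :
  (n <= d)%N -> f 0 = 0 -> \sum_i f (pad_out d N i j) = \sum_i f (N i j).
Proof.
move=> nd f0; have [z ->] : exists z, d = (n + z)%N.
  by exists (d - n)%N; rewrite subnKC.
rewrite big_split_ord /= [X in _ + X]big1 ?addr0 => [|i _].
  by apply: eq_bigr => i _; rewrite mxE /= valK.
by rewrite mxE insubN //= -leqNgt leq_addr.
Qed.

Lemma is_channel_pad_out d n m (N : 'M[R]_(n, m)) :
  (n <= d)%N -> is_channel N -> is_channel (pad_out d N).
Proof.
move=> nd [m0 N0 N1]; split=> // [i j|j]; last by rewrite (@sum_pad_out d _ _ _ id).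
by rewrite mxE; case: insubP.
Qed.

Lemma entropy_pad_out d n (p : 'cV[R]_n) :
  (n <= d)%N -> entropy (pad_out d p) = entropy p.
Proof.
by move=> nd; rewrite /entropy (@sum_pad_out _ _ _ _ (fun x => x * ln x)) ?mul0r.
Qed.

Lemma col_pad_out d n m (N : 'M[R]_(n, m)) j :
  col j (pad_out d N) = pad_out d (col j N).
Proof.
by apply/matrixP => i k; rewrite !mxE; case: insub => // i'; rewrite mxE.
Qed.

Lemma entries_pad_out z n (p : 'cV[R]_n) :
  entries (pad_out (n + z) p) = entries p ++ nseq z 0.
Proof.
(* Extending [p] by zero to all naturals makes both entry lists maps over [iota]. *)
pose F i := if insub i is Some i' then p i' 0 else 0.
have FE : entries p = [seq F i | i <- iota 0 n].
  rewrite -val_enum_ord -map_comp; apply: eq_map => i /=.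
  by rewrite /F valK.
rewrite FE /entries (eq_map (g := F \o val)); last by move=> i; rewrite mxE.
rewrite map_comp val_enum_ord iotaD map_cat add0n; congr (_ ++ _).
rewrite -{2}(size_iota n z) -(size_map F); apply/all_pred1P/allP => x.
case/mapP => i; rewrite mem_iota => /andP[ni _] ->.
by rewrite /F insubN //= -leqNgt.
Qed.

(** For nonnegative entries the added zeros can be placed last in the sorted list, where they
    contribute nothing. *)
Lemma topk_cat_zeros (s : seq R) z k :
  {in s, forall x, 0 <= x} -> topk (s ++ nseq z 0) k = topk s k.
Proof.
move=> s0; rewrite /topk; set ge := (X in sort X).
have ge_tr : transitive ge by move=> y x w xy yw; exact: le_trans yw xy.
have ge_tot : total ge by move=> x y; exact: le_total.
have -> : sort ge (s ++ nseq z 0) = sort ge s ++ nseq z 0.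
  apply: (sorted_eq ge_tr).
  - by move=> x y /le_anti.
  - exact: sort_sorted.
  - rewrite (sorted_pairwise ge_tr) pairwise_cat -!(sorted_pairwise ge_tr).
    rewrite sort_sorted //=; apply/andP; split.
      apply/allrelP => x y; rewrite mem_sort => /s0 x0.
      by move=> /nseqP[-> _].
    case: z => //= z; elim: z => //= z ->; by rewrite /ge lexx.
  - by rewrite perm_sort perm_cat2r perm_sym perm_sort.
rewrite take_cat; case: ltnP => // sk.
rewrite big_cat /= [take k _]take_oversize // -[RHS]addr0; congr (_ + _).
by rewrite big1_seq // => x /andP[_ /mem_take /nseqP[]].
Qed.

Lemma topk_pad_out d n (p : 'cV[R]_n) k :
  (n <= d)%N -> (forall i, 0 <= p i 0) ->
  topk (entries (pad_out d p)) k = topk (entries p) k.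
Proof.
move=> /subnKC <- p0; rewrite entries_pad_out topk_cat_zeros // => x.
by case/mapP => i _ ->.
Qed.

End Padding.

Section ChannelMajorization.
Context {R : realType}.

Lemma sum_mxtens m n (F : 'I_(m * n) -> R) :
  \sum_a F a = \sum_i \sum_j F (mxtens_index (i, j)).
Proof.
rewrite pair_big /= (reindex (@mxtens_index m n)) /=.
  by apply: eq_bigr => -[].
by exists (@mxtens_unindex m n) => i _; rewrite (mxtens_indexK, mxtens_unindexK).
Qed.

(** The identity factor keeps only equal values of [z]: [S] draws a pair [(j, z)], and column [j] of
    [N] then passes through the map of [D] selected by [z]. *)
Lemma chmaj_compE d m k m' (N : 'M[R]_(d, m)) (S : 'M[R]_(m * k, m'))
    (D : 'M[R]_(d, d * k)) y x :
  (D *m (N *t (1%:M : 'M[R]_k)) *m S) y x =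
  \sum_j \sum_z S (mxtens_index (j, z)) x *
    \sum_y' D y (mxtens_index (y', z)) * N y' j.
Proof.
rewrite mxE sum_mxtens; apply: eq_bigr => j _; apply: eq_bigr => z _.
rewrite mulrC mxE sum_mxtens; congr (_ * _); apply: eq_bigr => y' _.
rewrite (bigD1 z) //= [X in _ + X]big1 ?addr0 => [|z' z'z]; rewrite tensmxE mxE.
  by rewrite eqxx mulr1.
by rewrite (negbTE z'z) !mulr0.
Qed.

Lemma is_channel_out_gt0 n m (N : 'M[R]_(n, m)) : is_channel N -> (0 < n)%N.
Proof.
case: n N => // N [m0 _ /(_ (Ordinal m0))/eqP].
by rewrite big_ord0 eq_sym oner_eq0.
Qed.

Lemma is_channel_col n m (N : 'M[R]_(n, m)) j :
  is_channel N -> is_channel (col j N).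
Proof.
move=> [_ N0 N1]; split=> // [i k|k]; first by rewrite mxE.
by under eq_bigr do rewrite mxE.
Qed.

Lemma is_channel_tensmx n m n' m' (N : 'M[R]_(n, m)) (M : 'M[R]_(n', m')) :
  is_channel N -> is_channel M -> is_channel (N *t M).
Proof.
move=> [m0 N0 N1] [m0' M0 M1]; split=> [|i j|j].
- by rewrite muln_gt0 m0.
- by rewrite mxE mulr_ge0.
- case: (mxtens_indexP j) => x x'; rewrite sum_mxtens -(N1 x).
  apply: eq_bigr => i _; under eq_bigr do rewrite tensmxE.
  by rewrite -mulr_sumr M1 mulr1.
Qed.

Lemma is_channel_ntensmx n m (N : 'M[R]_(n, m)) k :
  is_channel N -> is_channel (N ^t k.+1).
Proof.
move=> N1; elim: k => // k IH; rewrite ntensmxSS.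
exact: is_channel_tensmx.
Qed.

(** Take [Z] trivial, let [S] always feed in [x], and let [D] be the identity. *)
Lemma chmaj_col n m (N : 'M[R]_(n, m)) x : is_channel N -> chmaj N (col x N).
Proof.
move=> N1; rewrite /chmaj -col_pad_out; set P := pad_out _ N.
have [m0 _ _] := N1.
pose S : 'M[R]_(m * 1, 1) := \matrix_(a, b) ((mxtens_unindex a).1 == x)%:R.
have SE j z b : S (mxtens_index (j, z)) b = (j == x)%:R.
  by rewrite mxE mxtens_indexK.
pose D : 'M[R]_(maxn n n, maxn n n * 1) :=
  \matrix_(y, b) (y == (mxtens_unindex b).1)%:R.
have DE y y' z : D y (mxtens_index (y', z)) = (y == y')%:R.
  by rewrite mxE mxtens_indexK.
exists 1%N, S, D; split.
- split=> // [a b|b]; first by rewrite mxE ler0n.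
  rewrite sum_mxtens (bigD1 x) //= [X in _ + X]big1 => [|j jx].
    by rewrite big_ord1 SE eqxx addr0.
  by rewrite big_ord1 SE (negbTE jx).
- split=> [|a b|b]; last 2 first.
  + by rewrite mxE ler0n.
  + case: (mxtens_indexP b) => y' z.
    rewrite (bigD1 y') //= DE eqxx big1 ?addr0 // => y yy'.
    by rewrite DE (negbTE yy').
  by rewrite muln1 maxnn (is_channel_out_gt0 _ _ _ N1).
- move=> z; rewrite (_ : \matrix_(_, _) _ = 1%:M); first exact: doubly_stochastic1.
  by apply/matrixP => i j; rewrite mxE DE mxE.
- apply/matrixP => y b; rewrite chmaj_compE (bigD1 x) //= [X in _ + X]big1 => [|j jx].
    rewrite big_ord1 SE eqxx mul1r (bigD1 y) //= DE eqxx mul1r mxE big1 ?addr0 //.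
    by move=> y' y'y; rewrite DE eq_sym (negbTE y'y) mul0r.
  by rewrite big_ord1 SE (negbTE jx) mul0r.
Qed.

(** Let [Z] be a copy of the input of [N]: [S] stores [x] in [Z], and [D] applies the doubly
    stochastic matrix taking the padded [q] to the padded column [x]. *)
Lemma vmaj_chmaj l n m (q : 'cV[R]_l) (N : 'M[R]_(n, m)) :
  is_channel q -> is_channel N -> (forall x, vmaj q (col x N)) -> chmaj q N.
Proof.
move=> q1 N1 qN; rewrite /chmaj; set d := maxn l n.
have ld : (l <= d)%N by rewrite leq_maxl.
have nd : (n <= d)%N by rewrite leq_maxr.
have [_ Q0 Q1] := is_channel_pad_out _ _ _ _ ld q1.
have [_ P0 P1] := is_channel_pad_out _ _ _ _ nd N1.
set Q := pad_out d q; set P := pad_out d N.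
have /choice[D DP] : forall x, exists D : 'M[R]_d,
    doubly_stochastic D /\ col x P = D *m Q.
  move=> x; have [| |D Dds DE] := vmaj_doubly_stochastic (col x P) Q; last by exists D.
  - move=> k; rewrite col_pad_out !topk_pad_out ?qN //.
    + by case: q1.
    + by move=> i; rewrite mxE; case: N1.
  - by rewrite Q1; under eq_bigr do rewrite mxE; rewrite P1.
have [m0 _ _] := N1.
pose S : 'M[R]_(1 * m, m) := \matrix_(a, x) ((mxtens_unindex a).2 == x)%:R.
have SE j z x : S (mxtens_index (j, z)) x = (z == x)%:R.
  by rewrite mxE mxtens_indexK.
pose E : 'M[R]_(d, d * m) :=
  \matrix_(y, b) D (mxtens_unindex b).2 y (mxtens_unindex b).1.
have EE y y' z : E y (mxtens_index (y', z)) = D z y y'.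
  by rewrite mxE mxtens_indexK.
exists m, S, E; split.
- split=> // [a b|b]; first by rewrite mxE ler0n.
  rewrite sum_mxtens big_ord1 (bigD1 b) //= SE eqxx big1 ?addr0 // => j jx.
  by rewrite SE (negbTE jx).
- have Dds x : doubly_stochastic (D x) by case: (DP x).
  split=> [|a b|b].
  + by rewrite muln_gt0 m0 andbT (leq_trans _ nd) // (is_channel_out_gt0 _ _ _ N1).
  + by rewrite mxE; case: (Dds (mxtens_unindex b).2).
  + by under eq_bigr do rewrite mxE; case: (Dds (mxtens_unindex b).2).
- move=> z; rewrite (_ : \matrix_(_, _) _ = D z); first by case: (DP z).
  by apply/matrixP => i j; rewrite mxE EE.
- apply/matrixP => y x; rewrite chmaj_compE big_ord1 (bigD1 x) //= [X in _ + X]big1.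
    rewrite SE eqxx mul1r addr0.
    have [_ /matrixP/(_ y 0)] := DP x; rewrite mxE => ->; rewrite mxE.
    by apply: eq_bigr => y' _; rewrite EE.
  by move=> z zx; rewrite SE (negbTE zx) mul0r.
Qed.

End ChannelMajorization.

(** * Entropy and the maximal extension *)

Section Entropy.
Context {R : realType}.

(** The left side is the tangent at [c] of the convex function [x * ln x]. For [x > 0] the bound is
    [ln u <= u - 1] at [u = c / x], multiplied by [x]. *)
Lemma xlnx_ge_tangent (x c : R) :
  0 <= x -> 0 < c -> x * ln c + x - c <= x * ln x.
Proof.
rewrite le_eqVlt => /predU1P[<-|x0] c0; first by rewrite !mul0r add0r sub0r oppr_le0 ltW.
have cx0 : 0 < c / x by rewrite divr_gt0.
have : ln (c / x) <= c / x - 1.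
  by rewrite -[in leLHS](subrK 1 (c / x)) addrC le_ln1Dx // ltrBrDl subrr.
rewrite lnM ?lnV ?posrE ?invr_gt0 // => /(ler_wpM2l (ltW x0)).
by rewrite mulrBr mulrBr mulrCA divff ?gt_eqF // !mulr1; lra.
Qed.

(** Average the tangent bound taken at the mean [c]; the terms linear in [f i - c] cancel. The case
    [c = 0] is separate because the tangent needs [c > 0]. *)
Lemma xlnx_jensen (I : finType) (w f : I -> R) :
  (forall i, 0 <= w i) -> (forall i, 0 <= f i) -> \sum_i w i = 1 ->
  (\sum_i w i * f i) * ln (\sum_i w i * f i) <= \sum_i w i * (f i * ln (f i)).
Proof.
move=> w0 f0 w1; set c := \sum_i w i * f i.
have : 0 <= c by apply: sumr_ge0 => i _; rewrite mulr_ge0.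
rewrite le_eqVlt => /predU1P[c0|c0].
  rewrite -c0 mul0r sumr_ge0 // => i _.
  have /eqP : w i * f i = 0.
    by apply: (psumr_eq0P _ (esym c0)) => // j _; rewrite mulr_ge0.
  by rewrite mulrA => /eqP ->; rewrite mul0r.
have -> : c * ln c = \sum_i w i * (f i * ln c + f i - c).
  under eq_bigr do rewrite mulrBr mulrDr mulrA.
  by rewrite sumrB big_split /= -!mulr_suml w1 -/c; ring.
by apply: ler_sum => i _; rewrite ler_wpM2l // xlnx_ge_tangent.
Qed.

Lemma channel_le1 n m (N : 'M[R]_(n, m)) i j : is_channel N -> N i j <= 1.
Proof.
by move=> [_ N0 N1]; rewrite -(N1 j) (bigD1 i) //= lerDl sumr_ge0.
Qed.

Lemma minH_le n m (N : 'M[R]_(n, m.+1)) x : minH N <= entropy (col x N).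
Proof. exact: bigmin_le. Qed.

Lemma minH_attained n m (N : 'M[R]_(n, m.+1)) :
  exists x, minH N = entropy (col x N).
Proof.
rewrite /minH; elim/big_ind: _ => [|a b [x ->] [y ->]|x _].
- by exists ord0.
- by rewrite /Num.min; case: ifP => _; [exists x | exists y].
- by exists x.
Qed.

(* Each entry of the output is an average of entries of the columns of N, so
   the convexity of x ln x applies once, to the whole mixture. *)
Lemma chmaj_minH_le n m l (N : 'M[R]_(n, m.+1)) (q : 'cV[R]_l) :
  is_channel N -> chmaj N q -> minH N <= entropy q.
Proof.
move=> N1; rewrite /chmaj; set d := maxn n l.
have nd : (n <= d)%N by rewrite leq_maxl.
have ld : (l <= d)%N by rewrite leq_maxr.
rewrite -(entropy_pad_out d _ q ld).
have [_ P0 P1] := is_channel_pad_out _ _ _ _ nd N1.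
set P := pad_out d N in P0 P1 *; set Q := pad_out d q.
move=> [k [S [D [[_ S0 S1] [_ D0 D1] Dds QE]]]].
have sum3 (F : 'I_m.+1 * 'I_k * 'I_d -> R) :
    \sum_u F u = \sum_j \sum_z \sum_y F ((j, z), y).
  by rewrite !pair_big /=; apply: eq_bigr => -[[]].
pose s j z := S (mxtens_index (j, z)) 0.
have s1 : \sum_j \sum_z s j z = 1 by rewrite -(S1 0) sum_mxtens.
pose w y (u : 'I_m.+1 * 'I_k * 'I_d) :=
  s u.1.1 u.1.2 * D y (mxtens_index (u.2, u.1.2)).
have QyE y : Q y 0 = \sum_u w y u * P u.2 u.1.1.
  rewrite QE chmaj_compE sum3; apply: eq_bigr => j _; apply: eq_bigr => z _.
  by rewrite mulr_sumr; apply: eq_bigr => y' _; rewrite mulrA.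
(* For fixed [y] the weights sum to 1 because the rows of each [D(., z)] do: here double
   stochasticity enters. *)
have w1 y : \sum_u w y u = 1.
  rewrite sum3 -s1; apply: eq_bigr => j _; apply: eq_bigr => z _.
  rewrite /w /= -mulr_sumr; have [_ /(_ y) Dy _] := Dds z.
  by move: Dy; under eq_bigr do rewrite mxE; move=> ->; rewrite mulr1.
have : \sum_y Q y 0 * ln (Q y 0) <=
       \sum_y \sum_u w y u * (P u.2 u.1.1 * ln (P u.2 u.1.1)).
  apply: ler_sum => y _; rewrite QyE; apply: xlnx_jensen => // u.
  by apply: mulr_ge0; [exact: S0 | exact: D0].
(* Summing over [y] first uses the column sums of [D] and leaves the average of the column entropies
   under [s]. *)
have -> : \sum_y \sum_u w y u * (P u.2 u.1.1 * ln (P u.2 u.1.1)) =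
          - \sum_j \sum_z s j z * entropy (col j N).
  rewrite exchange_big sum3 -sumrN; apply: eq_bigr => j _.
  rewrite -sumrN; apply: eq_bigr => z _.
  rewrite -(entropy_pad_out d) // -col_pad_out /entropy mulrN opprK mulr_sumr.
  apply: eq_bigr => y' _; rewrite -mulr_suml /w /= -mulr_sumr D1 mulr1.
  by rewrite -/P (_ : col j P y' 0 = P y' j) // mxE.
rewrite lerNr => /(le_trans _); apply.
rewrite -[leLHS]mul1r -s1 mulr_suml; apply: ler_sum => j _.
rewrite mulr_suml; apply: ler_sum => z _.
by rewrite ler_wpM2l ?minH_le // S0.
Qed.

(** A vector is a channel with a single input, for which [minH] is its entropy. *)
Lemma vmaj_entropy_le l n (q : 'cV[R]_l) (p : 'cV[R]_n) :
  is_channel q -> is_channel p -> vmaj q p -> entropy q <= entropy p.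
Proof.
move=> q1 p1 qp; have colid k (r : 'cV[R]_k) x : col x r = r.
  by apply/colP => i; rewrite mxE (ord1 x).
have [x] := minH_attained _ _ q; rewrite colid => <-.
by apply: chmaj_minH_le => //; apply: vmaj_chmaj => // y; rewrite colid.
Qed.

(** A column of least entropy is admissible in the infimum and attains the lower bound
    [chmaj_minH_le]. *)
Lemma Hmax_minH n m (N : 'M[R]_(n, m.+1)) : is_channel N -> Hmax N = minH N.
Proof.
move=> N1; have [x xE] := minH_attained _ _ N.
have Nx : [set r | exists (l : nat) (q : 'cV[R]_l),
    [/\ is_channel q, chmaj N q & r = entropy q]] (minH N).
  exists n, (col x N); split=> //; first exact: is_channel_col.
  exact: chmaj_col.
have lb : lbound [set r | exists (l : nat) (q : 'cV[R]_l),
    [/\ is_channel q, chmaj N q & r = entropy q]] (minH N).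
  by move=> _ [l [q [q1 Nq ->]]]; exact: chmaj_minH_le.
apply/eqP; rewrite eq_le ge_inf //=; last by exists (minH N).
by apply: lb_le_inf => //; exists (minH N).
Qed.

End Entropy.

(** * The regularized minimal extension *)

Section MinimalExtension.
Context {R : realType}.

Definition Hmin_set {n m} (N : 'M[R]_(n, m)) : set R :=
  [set r | exists (l : nat) (q : 'cV[R]_l),
     [/\ is_channel q, (forall x : 'I_m, vmaj q (col x N)) & r = entropy q]].

(** * Chernoff bounds on sums of largest entries *)

Lemma sum_take_le (s : seq R) (f : R -> R) k :
  {in s, forall x, 0 <= f x} -> \sum_(x <- take k s) f x <= \sum_(x <- s) f x.
Proof.
move=> s0; rewrite -{2}(cat_take_drop k s) big_cat /= lerDl big_seq sumr_ge0 //.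
by move=> x /mem_drop /s0.
Qed.

(** At most [k] entries are selected, each costing [lam] plus its [f]-value; since [f >= 0], the
    [f]-values may be summed over all entries. *)
Lemma topk_le_sum n (p : 'cV[R]_n) (lam : R) (f : R -> R) k :
  0 <= lam -> (forall x, 0 <= x -> 0 <= f x) ->
  (forall x, 0 <= x -> x <= lam + f x) -> (forall i, 0 <= p i 0) ->
  topk (entries p) k <= k%:R * lam + \sum_i f (p i 0).
Proof.
move=> lam0 f0 flam p0; rewrite /topk; set s := sort _ _.
have s0 : {in s, forall x, 0 <= x}.
  by move=> x; rewrite mem_sort => /mapP[i _ ->].
have -> : \sum_i f (p i 0) = \sum_(x <- s) f x.
  rewrite (perm_big (entries p)) ?perm_sort //= /entries big_map big_enum //=.
apply: (@le_trans _ _ (\sum_(x <- take k s) (lam + f x))).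
  by rewrite big_seq [leRHS]big_seq; apply: ler_sum => x /mem_take /s0 /flam.
rewrite big_split /= lerD //; last first.
  by apply: sum_take_le => x /s0 /f0.
rewrite big_const_seq count_predT iter_addr addr0 mulr_natl; apply: ler_wpMn2l => //.
by rewrite size_take; case: ltnP.
Qed.

Lemma topk_le1 n (p : 'cV[R]_n) k : is_channel p -> topk (entries p) k <= 1.
Proof.
move=> [_ p0 p1]; have := topk_le_sum _ p 0 id k (lexx 0).
by rewrite mulr0 add0r p1; apply=> // x; rewrite add0r.
Qed.

Lemma topk_le_nat n (p : 'cV[R]_n) k : is_channel p -> topk (entries p) k <= k%:R.
Proof.
move=> p1; case: k => [|k]; first by rewrite /topk take0 big_nil.
by rewrite (le_trans (topk_le1 _ _ _ p1)) // ler1n.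
Qed.

(** The sum of [p_i^(1+t)], that is [exp(-t H)] with [H] the Rényi entropy of order [1+t] when
    [t > 0]. In this form the factor [p i 0] removes zero entries, whatever the value of [ln 0]. *)
Definition tilted_mass (t : R) {n} (p : 'cV[R]_n) : R :=
  \sum_i p i 0 * expR (t * ln (p i 0)).

(** An entry [x] is either at most [lam], or at most [x * (x / lam)^t]. *)
Lemma topk_le_tilted (t lam : R) n (p : 'cV[R]_n) k :
  0 <= t -> 0 < lam -> (forall i, 0 <= p i 0) ->
  topk (entries p) k <= k%:R * lam + expR (- (t * ln lam)) * tilted_mass t p.
Proof.
move=> t0 lam0 p0; rewrite mulr_sumr.
apply: (topk_le_sum _ _ _ (fun x => expR (- (t * ln lam)) * (x * expR (t * ln x)))) => //.
- exact: ltW.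
- by move=> x x0; rewrite !mulr_ge0 // expR_ge0.
- move=> x x0; have [xlam|lamx] := leP x lam.
    by rewrite (le_trans xlam) // lerDl !mulr_ge0 // expR_ge0.
  rewrite mulrCA -expRD ler_wpDl ?(ltW lam0) // -[leLHS]mulr1 ler_wpM2l //.
  rewrite -expR0 ler_expR addrC subr_ge0 ler_wpM2l // ler_ln ?posrE ?(ltW lamx) //.
  exact: lt_trans lamx.
Qed.

Lemma tilted_massM (t : R) n m n' m' (N : 'M[R]_(n, m)) (M : 'M[R]_(n', m')) x y :
  (forall i j, 0 <= N i j) -> (forall i j, 0 <= M i j) ->
  tilted_mass t (col (mxtens_index (x, y)) (N *t M)) =
  tilted_mass t (col x N) * tilted_mass t (col y M).
Proof.
move=> N0 M0; rewrite /tilted_mass sum_mxtens mulr_suml; apply: eq_bigr => i _.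
rewrite mulr_sumr; apply: eq_bigr => j _.
rewrite !mxE !mxtens_indexK /=.
have := N0 i x; rewrite le_eqVlt => /predU1P[<-|Nx]; first by rewrite !mul0r.
have := M0 j y; rewrite le_eqVlt => /predU1P[<-|My]; first by rewrite !(mul0r, mulr0).
by rewrite lnM ?posrE // mulrDr expRD; ring.
Qed.

Lemma tilted_mass_ntensmx (t c : R) n m (N : 'M[R]_(n, m)) k x :
  is_channel N -> (forall x, tilted_mass t (col x N) <= c) ->
  tilted_mass t (col x (N ^t k.+1)) <= c ^+ k.+1.
Proof.
move=> N1 Nc; elim: k x => [|k IH] x; first exact: Nc.
rewrite [in leLHS]ntensmxSS; case: (mxtens_indexP x) => y z.
have [_ N0 _] := N1; have [_ M0 _] := is_channel_ntensmx _ _ _ k N1.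
rewrite tilted_massM // exprS; apply: ler_pM => //; apply: sumr_ge0 => i _.
- by rewrite mxE mulr_ge0 // expR_ge0.
- by rewrite mxE mulr_ge0 // expR_ge0.
Qed.

(** From [exp(-u) >= 1 - u] one gets [exp(u) <= 1 / (1 - u)], and
    [(1 - u)(1 + u + u^2) = 1 - u^3 >= 1] for [u <= 0]. *)
Lemma expR_le_quadratic (u : R) : u <= 0 -> expR u <= 1 + u + u ^+ 2.
Proof.
move=> u0; have u1 : 0 < 1 - u by lra.
have := expR_ge1Dx (- u); rewrite expRN -lef_pV2 ?posrE ?invr_gt0 ?expR_gt0 //.
rewrite invrK => /le_trans; apply; rewrite -[leLHS]mul1r ler_pdivrMr //.
have : 0 <= (- u) ^+ 3 by rewrite exprn_ge0 // oppr_ge0.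
by rewrite !exprS expr0; lra.
Qed.

(* d/dt tilted_mass at t = 0 is -H, which gives the exponential rate. *)
Lemma tilted_mass_bound n m (N : 'M[R]_(n, m.+1)) (e : R) :
  is_channel N -> 0 < e ->
  exists2 t : R, 0 < t &
    forall x, tilted_mass t (col x N) <= expR (- (t * (minH N - e))).
Proof.
move=> N1 e0; have [_ N0 N1c] := N1.
pose V x := \sum_i N i x * ln (N i x) ^+ 2.
have V0 x : 0 <= V x by apply: sumr_ge0 => i _; rewrite mulr_ge0 // sqr_ge0.
(* [C] dominates every second moment [V x] and is positive, so the single choice [t = e / C] gives
   [t * V x <= e] for all columns. *)
pose C := 1 + \sum_x V x.
have C0 : 0 < C by rewrite ltr_wpDr // sumr_ge0.
exists (e / C) => [|x]; first exact: divr_gt0.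
set t := e / C; have t0 : 0 < t by exact: divr_gt0.
apply: (@le_trans _ _ (1 - t * entropy (col x N) + t ^+ 2 * V x)).
  have -> : 1 - t * entropy (col x N) + t ^+ 2 * V x =
      \sum_i N i x * (1 + t * ln (N i x) + (t * ln (N i x)) ^+ 2).
    rewrite /entropy mulrN opprK -[in LHS](N1c x) !mulr_sumr -!big_split /=.
    by apply: eq_bigr => i _; rewrite !mxE; ring.
  apply: ler_sum => i _; rewrite mxE ler_wpM2l // expR_le_quadratic //.
  by rewrite pmulr_rle0 // ln_le0 // channel_le1.
rewrite -addrA; apply: le_trans (expR_ge1Dx _) _; rewrite ler_expR.
have tV : t * V x <= e.
  rewrite /t mulrAC ler_pdivrMr // ler_pM2l // /C (bigD1 x) //=.
  by rewrite addrCA lerDl addr_ge0 // sumr_ge0.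
have := ler_wpM2l (ltW t0) tV.
have := ler_wpM2l (ltW t0) (minH_le _ _ N x).
by rewrite expr2 mulrBr -mulrA; lra.
Qed.

(** * Vectors with one spike and a flat tail *)

Definition spike_flat (L : nat) (lam : R) : 'cV[R]_L.+1 :=
  \col_i (if i == 0 then 1 - L%:R * lam else lam).

Lemma sum_spike_flat L lam (f : R -> R) :
  \sum_i f (spike_flat L lam i 0) = f (1 - L%:R * lam) + L%:R * f lam.
Proof.
rewrite big_ord_recl mxE eqxx; congr (_ + _).
under eq_bigr do rewrite mxE /=.
by rewrite sumr_const card_ord mulr_natl.
Qed.

Lemma is_channel_spike_flat L lam :
  0 <= lam -> L%:R * lam <= 1 -> is_channel (spike_flat L lam).
Proof.
move=> lam0 L1; split=> // [i j|j]; first by rewrite mxE; case: eqP; rewrite ?subr_ge0.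
by rewrite (ord1 j) (sum_spike_flat L lam id) subrK.
Qed.

(** The hypothesis puts the spike above the flat height, so the entries are already in decreasing
    order. *)
Lemma topk_spike_flat L lam k : lam <= 1 - L%:R * lam ->
  topk (entries (spike_flat L lam)) k.+1 =
  1 - L%:R * lam + (minn k L)%:R * lam.
Proof.
move=> Llam; set a := 1 - L%:R * lam in Llam *.
have -> : entries (spike_flat L lam) = a :: nseq L lam.
  rewrite /entries enum_ordSl /= mxE; congr (_ :: _).
  rewrite -map_comp (eq_map (g := fun=> lam)); last by move=> i; rewrite /= mxE.
  by rewrite -[X in nseq X](size_enum_ord L); elim: (enum _) => //= _ s ->.
rewrite /topk sorted_sort; last 2 first.
- by move=> y x z xy yz; exact: le_trans yz xy.
- case: (L) => //= l; rewrite Llam /=.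
  by elim: l => //= l ->; rewrite lexx.
rewrite /= big_cons; congr (_ + _).
have [kL|Lk] := leqP k L.
  rewrite -(subnKC kL) nseqD take_size_cat ?size_nseq //.
  by rewrite big_nseq iter_addr addr0 mulr_natl.
rewrite take_oversize ?size_nseq ?(ltnW Lk) //.
by rewrite big_nseq iter_addr addr0 mulr_natl.
Qed.

(** The assumed bound at [k.+1] is exactly the sum of the spike and [k] flat entries; once the flat
    part is exhausted that sum is 1. *)
Lemma vmaj_spike_flat L lam n (p : 'cV[R]_n) :
  is_channel p -> lam <= 1 - L%:R * lam ->
  (forall k, topk (entries p) k <= k%:R * lam + (1 - L%:R * lam - lam)) ->
  vmaj (spike_flat L lam) p.
Proof.
move=> p1 Llam ptop [|k]; first by rewrite /topk !take0 !big_nil.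
rewrite topk_spike_flat //; have [kL|Lk] := leqP k L.
  by have := ptop k.+1; rewrite -natr1 mulrDl; lra.
by rewrite subrK topk_le1.
Qed.

(** * Bounds on the minimal extension *)

(** The vector [spike_flat 0 1] is a point mass, which majorizes every probability vector. *)
Lemma Hmin_set_nonempty n m (N : 'M[R]_(n, m)) :
  is_channel N -> Hmin_set N !=set0.
Proof.
move=> N1; exists (entropy (spike_flat 0 1)), 1%N, (spike_flat 0 1); split=> //.
  by apply: is_channel_spike_flat; rewrite ?mul0r.
move=> x; have c1 := is_channel_col _ _ N x N1.
apply: vmaj_spike_flat; rewrite ?mul0r ?subr0 // => k.
by rewrite mulr1 subrr addr0 topk_le_nat.
Qed.

Lemma Hmin_set_ub n m (N : 'M[R]_(n, m)) : is_channel N -> has_ubound (Hmin_set N).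
Proof.
move=> N1; have [m0 _ _] := N1; exists (entropy (col (Ordinal m0) N)).
move=> _ [l [q [q1 qN ->]]]; apply: vmaj_entropy_le => //.
exact: is_channel_col.
Qed.

(** Take the largest [L] with [(L + 1) * lam + delta <= 1]: the spike then exceeds the flat height
    by at least [delta], and the flat part has mass above [1 - delta - 2 * lam]. The entropy is
    bounded below by the flat part alone. *)
Lemma Hmin_ge n m (N : 'M[R]_(n, m)) (lam delta : R) :
  is_channel N -> 0 < lam -> 0 <= delta -> lam + delta <= 1 ->
  (forall x k, topk (entries (col x N)) k <= k%:R * lam + delta) ->
  (1 - delta - 2 * lam) * - ln lam <= Hmin N.
Proof.
move=> N1 lam0 delta0 ld Ntop; set y := (1 - delta - lam) / lam.
have y0 : 0 <= y by apply: divr_ge0; [lra | exact: ltW].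
have /andP[] := truncn_itv y0; set L := Num.trunc y.
rewrite ler_pdivlMr // ltr_pdivrMr // -natr1 mulrDl mul1r => yL Ly.
have q1 : is_channel (spike_flat L lam).
  by apply: is_channel_spike_flat; [exact: ltW | lra].
apply: (@le_trans _ _ (entropy (spike_flat L lam))).
  rewrite /entropy (sum_spike_flat _ _ (fun x => x * ln x)) mulrN lerN2.
  have lnlam : ln lam <= 0 by rewrite ln_le0 //; lra.
  have a1 : (1 - L%:R * lam) * ln (1 - L%:R * lam) <= 0.
    apply: mulr_ge0_le0; first lra.
    by rewrite ln_le0 // lerBlDr lerDl mulr_ge0 // ltW.
  have := ler_wnM2r lnlam (_ : 1 - delta - 2 * lam <= L%:R * lam).
  by move=> /(_ ltac:(lra)); lra.
apply: ub_le_sup; first exact: Hmin_set_ub.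
exists L.+1, (spike_flat L lam); split=> // x.
apply: vmaj_spike_flat; [exact: is_channel_col | lra |] => k.
by apply: (le_trans (Ntop x k)); lra.
Qed.

Lemma Hmin_ge0 n m (N : 'M[R]_(n, m)) : is_channel N -> 0 <= Hmin N.
Proof.
move=> N1; have := Hmin_ge _ _ N 1 0 N1 ltr01 (lexx 0).
rewrite ln1 oppr0 mulr0; apply=> [|x k]; first by rewrite addr0.
by rewrite mulr1 addr0 topk_le_nat //; exact: is_channel_col.
Qed.

(* Outside a set of mass [b ^+ k], the probabilities under any column of
   [N ^t k] are at most [a ^+ k], so every column is majorized by one spike
   followed by a flat part of height [a ^+ k]. *)
Lemma Hmin_ntensmx_ge n m (N : 'M[R]_(n, m.+1)) (e : R) :
  is_channel N -> 0 < e ->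
  \forall k \near \oo, minH N - e <= k%:R^-1 * Hmin (N ^t k).
Proof.
move=> N1 e0; have [he|he] := leP (minH N - e) 0.
  apply: filterS (nbhs_infty_gt 0) => -[//|k] _; apply: (le_trans he).
  by rewrite mulr_ge0 ?invr_ge0 ?ler0n //; apply/Hmin_ge0/is_channel_ntensmx.
(* The flat height decays at rate [g] and the tilted mass is controlled with loss [e / 4]; the
   remaining gap [e / 4] makes the Chernoff term exactly [b ^+ k]. *)
pose g := minH N - e / 2.
have g0 : 0 < g by rewrite /g; lra.
have [t t0 tN] := tilted_mass_bound _ _ N _ N1 (divr_gt0 e0 (ltr0n _ 4)).
pose a := expR (- g); pose b := expR (- (t * (e / 4))).
have a1 : `|a| < 1 by rewrite gtr0_norm ?expR_gt0 // expR_lt1; lra.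
have b1 : `|b| < 1.
  by rewrite gtr0_norm ?expR_gt0 // expR_lt1 oppr_lt0 mulr_gt0 // divr_gt0.
(* Chosen so that [4 * eta <= 1] and [(1 - 4 * eta) * g >= g - e / 2 = minH N - e]; the factor 4
   covers the loss [b ^+ k + 2 * a ^+ k]. *)
pose eta := Num.min 1 (e / 2 / g) / 4.
have eta0 : 0 < eta by rewrite divr_gt0 // lt_min ltr01 !divr_gt0.
have eta1 : 4 * eta <= 1 by rewrite mulrC divfK // ge_min lexx.
have etag : 4 * eta * g <= e / 2.
  by rewrite [4 * _]mulrC divfK // -ler_pdivlMr // ge_min lexx orbT.
have main k : (0 < k)%N -> a ^+ k <= eta -> b ^+ k <= eta ->
    minH N - e <= k%:R^-1 * Hmin (N ^t k).
  case: k => // k _ ak bk.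
  have ak0 : 0 < a ^+ k.+1 by rewrite exprn_gt0 // expR_gt0.
  have bk0 : 0 < b ^+ k.+1 by rewrite exprn_gt0 // expR_gt0.
  have lnak : ln (a ^+ k.+1) = - (k.+1%:R * g) by rewrite -expRM_natl expRK mulrN.
  have Nk := is_channel_ntensmx _ _ _ k N1.
  have := Hmin_ge _ _ (N ^t k.+1) (a ^+ k.+1) (b ^+ k.+1) Nk ak0 (ltW bk0).
  move=> /(_ ltac:(lra)) H; rewrite ler_pdivlMl ?ltr0n //.
  apply: le_trans (H _) => [|x j].
    rewrite lnak opprK mulrCA; apply: ler_wpM2l; first exact: ler0n.
    have ab : 1 - 4 * eta <= 1 - b ^+ k.+1 - 2 * a ^+ k.+1 by lra.
    have := ler_wpM2r (ltW g0) ab.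
    by rewrite mulrBl mul1r {1}/g; lra.
  apply: le_trans (topk_le_tilted t _ _ _ j (ltW t0) ak0 _) _.
    by move=> i; rewrite mxE; case: Nk.
  rewrite lerD2l.
  apply: le_trans (ler_wpM2l (expR_ge0 _) (tilted_mass_ntensmx _ _ _ _ _ k x N1 tN)) _.
  rewrite lnak -!expRM_natl -expRD ler_expR /g le_eqVlt; apply/orP; left.
  by apply/eqP; field.
near=> k; apply: main.
- by near: k; exact: nbhs_infty_gt.
- near: k; have /cvgrPdist_le/(_ _ eta0) := cvg_expr a1.
  by apply: filterS => k; rewrite sub0r normrN; exact/le_trans/ler_norm.
- near: k; have /cvgrPdist_le/(_ _ eta0) := cvg_expr b1.
  by apply: filterS => k; rewrite sub0r normrN; exact/le_trans/ler_norm.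
Unshelve. all: by end_near.
Qed.

End MinimalExtension.

Theorem theorem20 (R : realType) (HH : forall n m : nat, 'M[R]_(n, m) -> R)
  (HH_mono : forall (n m n' m' : nat) (N : 'M[R]_(n, m)) (M : 'M[R]_(n', m')),
      is_channel N -> is_channel M -> chmaj N M -> HH _ _ N <= HH _ _ M)
  (HH_add : forall (n m n' m' : nat) (N : 'M[R]_(n, m)) (M : 'M[R]_(n', m')),
      is_channel N -> is_channel M -> HH _ _ (N *t M) = HH _ _ N + HH _ _ M)
  (HH_vec : forall (n : nat) (p : 'cV[R]_n), is_channel p -> HH _ _ p = entropy p)
  (m n : nat) (N : 'M[R]_(n, m.+1)) :
  is_channel N ->
  [/\ HH _ _ N = minH N,
      (fun k : nat => k%:R^-1 * Hmin (N ^t k)) @ \oo --> minH N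
    & Hmax N = minH N].
Proof.
move=> N1.
have HH_le : HH _ _ N <= minH N.
  have [x ->] := minH_attained _ _ N; rewrite -HH_vec; last exact: is_channel_col.
  by apply: HH_mono => //; [exact: is_channel_col | exact: chmaj_col].
have HH_pow k : HH _ _ (N ^t k.+1) = k.+1%:R * HH _ _ N.
  elim: k => [|k IH]; first by rewrite mul1r.
  rewrite ntensmxSS HH_add ?IH //; last exact: is_channel_ntensmx.
  by rewrite -[in RHS]natr1 mulrDl mul1r addrC.
have Hmin_le_HH k : (0 < k)%N -> k%:R^-1 * Hmin (N ^t k) <= HH _ _ N.
  case: k => // k _; have Nk := is_channel_ntensmx _ _ _ k N1.
  rewrite ler_pdivrMl ?ltr0n // -HH_pow; apply: ge_sup.
    exact: Hmin_set_nonempty Nk.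
  move=> _ [l [q [q1 qN ->]]]; rewrite -HH_vec //.
  by apply: HH_mono => //; exact: vmaj_chmaj.
(* For each [e] a single large [k] suffices: [minH N - e] is at most the normalized [Hmin], which is
   at most [HH N]. *)
have HHE : HH _ _ N = minH N.
  apply/eqP; rewrite eq_le HH_le /=; apply/ler_addgt0Pr => e e0.
  rewrite -lerBlDr.
  have [k _ kP] := filterI (Hmin_ntensmx_ge _ _ N e N1 e0) (nbhs_infty_gt 0).
  have [ke k0] := kP k (leqnn k).
  exact: le_trans ke (Hmin_le_HH k k0).
split=> //; last exact: Hmax_minH.
(* The upper half of the limit also comes from [HH], whose value is now known to be [minH N]. *)
apply/(@cvgrPdist_le R R) => e e0.
near=> k.
have k0 : (0 < k)%N by near: k; exact: nbhs_infty_gt.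
have ke : minH N - e <= k%:R^-1 * Hmin (N ^t k).
  by near: k; exact: Hmin_ntensmx_ge.
rewrite distrC ler_distl ke /=.
by rewrite (le_trans (Hmin_le_HH k k0)) // HHE lerDl ltW.
Unshelve. all: by end_near.
Qed.
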